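(* Let $l\ge2$ be an integer and $\lambda>\lambda_{l+1}$. There is a constant $\alpha(l,\lambda)\in(0,1)$, depending only on $l$ and $\lambda$, with the following property. Let $\mathfrak N$ be a $\lambda$-lacunary sequence of positive integers, let $T=\{t_{n,m}\}$ be a summation matrix satisfying conditions 1)–3) of the context, and let $c_m$, $m\in\mathfrak N_+^*(l)$, be complex numbers. If $$\sup_{n}\left|\sum_{m\in\mathfrak N_+^*(l)}t_{n,m}c_me^{2\pi imx}\right|<\infty$$ for every $x$ in a measurable set $E\subset(0,1)$ of Lebesgue measure $|E|>\alpha(l,\lambda)$, then $$\sum_{m\in\mathfrak N_+^*(l)}|c_m|^2<\infty .$$
   Context: For an integer $l\ge2$, $\lambda_{l+1}$ is the unique solution $x>1$ of $x^{l}=x^{l-1}+x^{l-2}+\dots+1$. A sequence of positive integers $\{n_k\}_{k\ge1}$ is $\lambda$-lacunary ($\lambda>1$) if $n_{k+1}/n_k>\lambda$ for all $k$. For $\mathfrak N=\{n_k\}_{k\ge1}$ and $s\ge1$, $\mathfrak N_+(s)$ is the set of integers of the form $n_{k_1}+n_{k_2}+\dots+n_{k_s}$ with $k_1>k_2>\dots>k_s\ge1$, and $\mathfrak N_+^*(l)=\bigcup_{1\le s\le l}\mathfrak N_+(s)$. Conditions on a matrix $T=\{t_{n,m}:\ m\in\mathbb Z,\ n=1,2,\ldots\}$ of numbers: 1) for each $n$ only finitely many of the $t_{n,m}$, $m\in\mathbb Z$, are nonzero; 2) there is a constant $M$ with $|t_{n,m}|\le M$ for all $n,m$; 3) $\lim_{n\to\infty}t_{n,m}=1$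 for every $m=1,2,\ldots$. *)

(* Defs.v *)
From mathcomp Require Import all_boot all_order all_algebra.
From mathcomp Require Import all_classical all_reals all_analysis.
From mathcomp Require Import complex ring.

Set Implicit Arguments.
Unset Strict Implicit.
Unset Printing Implicit Defensive.

Import Order.TTheory GRing.Theory Num.Theory.
Import numFieldNormedType.Exports.

Local Open Scope classical_set_scope.
Local Open Scope ring_scope.

Definition lambda_eqn (R : realType) (l : nat) : set R :=
  [set x | 1 < x /\ x ^+ l = \sum_(i < l) x ^+ i].

(* $\lambda_{l+1}$: note the shift of the index. *)
Definition lambda_succ (R : realType) (l : nat) : R := xget 0 (@lambda_eqn R l).

Lemma lambda_eqn_unique (R : realType) (l : nat) (x y : R) :
  lambda_eqn l x -> lambda_eqn l y -> x = y.
Proof.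
suff lt_absurd (a b : R) : lambda_eqn l a -> lambda_eqn l b -> a < b -> False.
  move=> hx hy; have [hlt|hlt|//] := ltgtP x y.
  - by case: (lt_absurd _ _ hx hy hlt).
  - by case: (lt_absurd _ _ hy hx hlt).
move=> [a1 ha] [b1 hb] ab.
have a0 : 0 < a by apply: lt_trans a1.
have b0 : 0 < b by apply: lt_trans b1.
have l0 : (0 < l)%N.
  case: l ha hb => // ha _; move: ha; rewrite big_ord0 expr0 => /eqP.
  by rewrite oner_eq0.
have : a ^+ l * \sum_(i < l) b ^+ i < b ^+ l * \sum_(i < l) a ^+ i.
  rewrite !mulr_sumr.
  apply: ltr_sum => [|i _].
    by apply/hasP; exists (Ordinal l0) => //; rewrite mem_index_enum.
  have [d dE d0] : exists2 d, l = (i + d)%N & (0 < d)%N.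
    by exists (l - i)%N; rewrite ?subnKC ?subn_gt0 // ltnW.
  have -> : a ^+ l = a ^+ i * a ^+ d by rewrite [in LHS]dE exprD.
  have -> : b ^+ l = b ^+ i * b ^+ d by rewrite [in LHS]dE exprD.
  have -> : a ^+ i * a ^+ d * b ^+ i = (a ^+ i * b ^+ i) * a ^+ d by ring.
  have -> : b ^+ i * b ^+ d * a ^+ i = (a ^+ i * b ^+ i) * b ^+ d by ring.
  rewrite ltr_pM2l ?mulr_gt0 ?exprn_gt0 //.
  by rewrite ltrXn2r -?lt0n // ltW.
by rewrite -ha -hb mulrC ltxx.
Qed.

Lemma lambda_succP (R : realType) (l : nat) :
  (2 <= l)%N -> lambda_eqn l (lambda_succ R l).
Proof.
move=> l2; apply: (@xgetPex _ 0 (@lambda_eqn R l)).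
pose p : {poly R} := 'X^l - \sum_(i < l) 'X^i.
have pE x : p.[x] = x ^+ l - \sum_(i < l) x ^+ i.
  by rewrite /p !hornerE horner_sum; under eq_bigr do rewrite hornerXn.
have p1 : p.[1] < 0.
  rewrite pE expr1n; under eq_bigr do rewrite expr1n.
  by rewrite sumr_const card_ord subr_lt0 ltr1n.
have p2 : p.[2] = 1.
  rewrite pE; have := subrX1 (2 : R) l.
  by rewrite (_ : 2 - 1 = 1 :> R) ?mul1r => [<-|]; ring.
have le12 : 1 <= 2 :> R by rewrite ler1n.
have p12 : p.[1] <= 0 <= p.[2] by rewrite p2 ler01 ltW.
have [x /andP[x1 _] /rootP px] := poly_ivt le12 p12.
exists x; split; last by apply/eqP; rewrite -subr_eq0 -pE px.
by rewrite lt_neqAle x1 andbT; apply: contraTneq p1 => ->; rewrite px ltxx.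
Qed.

(* The paper's $n_k$, $k \ge 1$, is [n k.-1] here. *)
Definition lacunary (R : realType) (lambda : R) (n : nat -> nat) : Prop :=
  (forall k, 0 < n k)%N /\
  (forall k, lambda < (n k.+1)%:R / (n k)%:R).

(* $\mathfrak N_+(s)$ *)
Definition plus_sums (n : nat -> nat) (s : nat) : set nat :=
  [set m | exists k : seq nat,
     [/\ size k = s, sorted gtn k & m = (\sum_(i <- k) n i)%N]].

(* $\mathfrak N_+^*(l)$ *)
Definition plus_sums_upto (n : nat -> nat) (l : nat) : set nat :=
  \bigcup_(s in [set s | (1 <= s <= l)%N]) plus_sums n s.

(* Row [n] here is the paper's row $n+1$. [R[i]^o] is [R[i]] with the topology
   of its modulus. *)
Definition summation_matrix (R : realType) (t : nat -> int -> R[i]) : Prop :=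
  [/\ forall n, finite_set [set m : int | t n m != 0],
      exists M : R, forall n m, Normc.normc (t n m) <= M &
      forall m : nat, (0 < m)%N ->
        (t n m%:Z : R[i]^o) @[n --> \oo] --> (1 : R[i]^o)].

(* $e^{2\pi i m x}$ *)
Definition trig_exp (R : realType) (m : nat) (x : R) : R[i] :=
  (cos (2 * pi * m%:R * x) +i* sin (2 * pi * m%:R * x))%C.

(* For a summation matrix the support is finite, so [\sum_(m \in _)] is the
   actual sum and not the default value 0. *)
Definition summation_mean (R : realType) (A : set nat) (t : nat -> int -> R[i])
    (c : nat -> R[i]) (n : nat) (x : R) : R[i] :=
  \sum_(m \in A) (t n m%:Z * c m * trig_exp m x).

(* [measurable] on [R] means Borel; this is Lebesgue measurability, i.e. the
   sigma-algebra on which [completed_lebesgue_measure] is a measure. *)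
Definition lebesgue_measurable (R : realType) (E : set R) : Prop :=
  ((wlength (@idfun R))^*)%mu.-cara.-measurable E.

(* Main.v *)
(* All summands n_k are positive, so in a representation of m as a sum of at most
   s of them the largest one lies in [m/s, m], and lacunarity leaves boundedly
   many choices for it. By induction the number of pairs (a, b) in N*_+(l) with
   a + b = m is at most some C depending only on l and lambda. Expanding P^2 then
   gives int |P|^4 <= C S^2 for every polynomial P with spectrum in N*_+(l) and
   coefficients p_m, where S = sum |p_m|^2. Hence the integral of |P|^2 off a set
   B with |B| >= 1 - 1/(4C) cannot exceed S/2, and |P|^2 <= K on B forces
   S <= 2K. This is applied to the means, which are uniformly bounded on a Borel
   set B of measure > alpha; finally t_{n,m} -> 1 passes the bound to the c_m. *)
Require Import Defs.
From mathcomp Require Import all_boot all_order all_algebra.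
From mathcomp Require Import all_classical all_reals all_analysis.
From mathcomp Require Import complex.
From mathcomp Require Import zify ring lra.
Import Order.TTheory GRing.Theory Num.Theory.
Import numFieldNormedType.Exports.
Local Open Scope classical_set_scope.
Local Open Scope ring_scope.

Set Implicit Arguments.
Unset Strict Implicit.
Unset Printing Implicit Defensive.

(** * Lacunary sequences: counting representations of an integer *)

Lemma lacunary_geom (R : realType) (lambda : R) (N : nat -> nat) :
  0 <= lambda -> lacunary lambda N ->
  forall k j, (N k)%:R * lambda ^+ j <= (N (k + j)%N)%:R.
Proof.
move=> l0 [N0 Nl] k; elim=> [|j IH]; first by rewrite addn0 expr0 mulr1.
rewrite exprSr mulrA addnS; apply: le_trans (_ : (N (k + j)%N)%:R * lambda <= _).
  exact: ler_wpM2r.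
by have := Nl (k + j)%N; rewrite ltr_pdivlMr ?ltr0n // mulrC => /ltW.
Qed.

(** If [k1] is the least index in the window, then [N k >= N k1 * lambda ^+ (k - k1)]. Once
    [lambda ^+ J > s], an index [k >= k1 + J] would give [N k > s * N k1 >= m]. The length [J] is
    fixed before the sequence is chosen. *)
Lemma lacunary_window (R : realType) (lambda : R) (s : nat) : 1 < lambda ->
  exists J : nat, forall N, lacunary lambda N -> forall m : nat,
  exists k0 : nat, forall k, (N k <= m <= s * N k)%N -> k \in iota k0 J.
Proof.
move=> l1.
have l0 : 0 <= lambda by apply: ltW; apply: lt_trans l1.
(* Bernoulli's inequality makes the powers of [lambda] unbounded. *)
have [J HJ] : exists J : nat, s%:R < lambda ^+ J.
  have Bern j : 1 + j%:R * (lambda - 1) <= lambda ^+ j.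
    elim: j => [|j IH]; first by rewrite mul0r addr0 expr0.
    rewrite exprS -natr1; apply: le_trans (ler_wpM2l l0 IH).
    have : 0 <= j%:R * (lambda - 1) ^+ 2 by rewrite mulr_ge0 // sqr_ge0.
    by nra.
  have d0 : 0 < lambda - 1 by rewrite subr_gt0.
  exists (Num.bound (s%:R / (lambda - 1))); apply: lt_le_trans (Bern _).
  have := archi_boundP (divr_ge0 (ler0n R s) (ltW d0)).
  by rewrite ltr_pdivrMr //; lra.
exists J => N Nl m.
have [[k0 hk0]|no] := pselect (exists k, (N k <= m <= s * N k)%N); last first.
  by exists 0%N => k hk; case: no; exists k.
have ex : exists k, (fun k => (N k <= m <= s * N k)%N) k by exists k0.
case: (ex_minnP ex) => k1 /andP[h1 h2] kmin; exists k1 => k /andP[h3 h4].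
rewrite mem_iota kmin ?h3 //= ltnNge; apply/negP => hk.
have := lacunary_geom l0 Nl k1 (k - k1)%N; rewrite subnKC ?kmin ?h3 //.
have : (s * N k1)%:R < (N k1)%:R * lambda ^+ (k - k1).
  rewrite natrM mulrC ltr_pM2l ?ltr0n; last by case: Nl.
  apply: lt_le_trans HJ _; apply: ler_weXn2l; first exact: ltW.
  by rewrite leq_subRL ?kmin ?h3.
move=> /lt_le_trans H /H; rewrite ltr_nat => H'.
by have := leq_trans H' (leq_trans h3 h2); rewrite ltnn.
Qed.

(* The summands are tagged so that the tagged part of a representation of [m]
   can be counted; the induction removes a summand [N k >= m / s]. *)
Lemma tagged_sums_bounded (R : realType) (lambda : R) (s : nat) : 1 < lambda ->
  exists C : nat, forall N, lacunary lambda N -> forall m : nat,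
  exists2 L : seq nat, (size L <= C)%N &
  forall w : seq (bool * nat), (size w <= s)%N ->
    (\sum_(x <- w) N x.2 = m)%N -> (\sum_(x <- w | x.1) N x.2)%N \in L.
Proof.
move=> l1; elim: s => [|s [C IH]].
  exists 1%N => N _ m; exists [:: 0%N] => // w; rewrite leqn0 size_eq0 => /eqP -> _.
  by rewrite big_nil inE.
have [J HJ] := lacunary_window s.+1 l1.
(* There are [J] candidates for the removed index. Each gives at most [C] sums with the removed
   summand untagged and [C] with it tagged. One more value, 0, covers the empty list. *)
exists (J * (C + C)).+1 => N Nl m.
have [k0 Hk0] := HJ N Nl m.
have [L HL1 HL2] : exists2 L : nat -> seq nat, forall k, (size (L k) <= C)%N &
    forall k (w : seq (bool * nat)), (size w <= s)%N ->
    (\sum_(x <- w) N x.2 = m - N k)%N -> (\sum_(x <- w | x.1) N x.2)%N \in L k.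
  have {}IH k := IH N Nl (m - N k)%N.
  exists (fun k => sval (cid2 (IH k))) => k; by case: cid2.
exists (0%N :: flatten [seq L k ++ [seq (N k + a)%N | a <- L k] | k <- iota k0 J]).
  rewrite /= ltnS size_flatten /shape -map_comp sumnE big_map.
  rewrite -[X in (_ <= X * _)%N](size_iota k0 J) -sum1_size big_distrl /=.
  apply: leq_sum => k _; rewrite mul1n size_cat size_map.
  exact: leq_add.
move=> w sw mE; rewrite inE; apply/orP.
have [->|wn0] := eqVneq w [::]; first by left; rewrite big_nil.
right.
(* If every summand were below [m / s.+1], then at most [s.+1] of them could not add up to [m].
   Strictness is encoded through [m.-1], which requires [0 < m]. *)
have [x xw hx] : exists2 x, x \in w & (m <= s.+1 * N x.2)%N.
  apply: contrapT => no.
  have lt x : x \in w -> (s.+1 * N x.2 < m)%N.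
    by move=> xw; rewrite ltnNge; apply/negP => hx; apply: no; exists x.
  have m0 : (0 < m)%N.
    case: w wn0 {sw mE no} lt => // x w _ /(_ x); rewrite inE eqxx => /(_ isT).
    exact: leq_ltn_trans.
  have : (\sum_(x <- w) s.+1 * N x.2 <= \sum_(x <- w) m.-1)%N.
    rewrite big_seq [leqRHS]big_seq; apply: leq_sum => x /lt.
    by case: (m) m0.
  rewrite -big_distrr /= mE big_const_seq count_predT iter_addn_0.
  by case: (m) m0 => // m' _ /=; nia.
have pw := perm_to_rem xw.
have xm : (N x.2 <= m)%N by rewrite -mE (perm_big _ pw) big_cons leq_addr.
have hk : x.2 \in iota k0 J by apply: Hk0; rewrite xm.
have sr : (size (rem x w) <= s)%N by rewrite size_rem //; case: (size w) sw.
have rE : (\sum_(y <- rem x w) N y.2 = m - N x.2)%N.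
  by rewrite -mE (perm_big _ pw) big_cons /= addKn.
apply/flatten_mapP; exists x.2 => //; rewrite mem_cat (perm_big _ pw) big_cons /=.
have HL := HL2 _ _ sr rE.
by case: ifP => _; apply/orP; [right; exact: map_f|left].
Qed.

(** Concatenate a representation of [a], tagged [true], with one of [m - a], tagged [false]. This is
    a tagged sum of at most [l + l] terms with total [m] and tagged part [a], so [a] lies in a list
    of bounded size. *)
Lemma plus_sums_reps (R : realType) (lambda : R) (l : nat) : 1 < lambda ->
  exists C : nat, forall N, lacunary lambda N -> forall m (F : seq nat),
  uniq F -> {subset F <= [pred a | `[< plus_sums_upto N l a >]]} ->
  (count (fun a => (a <= m) && (m - a \in F)) F <= C)%N.
Proof.
move=> l1; have [C HC] := tagged_sums_bounded (l + l) l1.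
exists C => N Nl m F uF FA.
have [L HL1 HL2] := HC N Nl m.
rewrite -size_filter; apply: leq_trans HL1; apply: uniq_leq_size.
  exact: filter_uniq.
move=> a; rewrite mem_filter => /andP[/andP[am maF] aF].
have /asboolP[s1 /= /andP[_ s1l] [k1 [k1s _ aE]]] := FA _ aF.
have /asboolP[s2 /= /andP[_ s2l] [k2 [k2s _ bE]]] := FA _ maF.
have := HL2 ([seq (true, i) | i <- k1] ++ [seq (false, i) | i <- k2]).
rewrite size_cat !size_map k1s k2s leq_add // => /(_ isT).
rewrite !big_cat !big_map /= big_pred0_eq addn0 -aE -bE subnKC //.
exact.
Qed.

(** * A Cauchy-Schwarz inequality, complex moduli and exponentials *)

Lemma sqr_sum_le (R : realDomainType) (I : Type) (s : seq I) (P : pred I)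
    (u : I -> R) :
  (\sum_(i <- s | P i) u i) ^+ 2 <= (count P s)%:R * \sum_(i <- s | P i) u i ^+ 2.
Proof.
rewrite -big_filter -[in leRHS]big_filter -size_filter.
elim: [seq _ <- _ | _] => [|i s' IH]; first by rewrite !big_nil mul0r expr0n.
rewrite !big_cons sqrrD.
have : (u i * \sum_(j <- s') u j) *+ 2 <= (size s')%:R * u i ^+ 2 +
    \sum_(j <- s') u j ^+ 2.
  have -> : (size s')%:R * u i ^+ 2 = \sum_(j <- s') u i ^+ 2.
    by rewrite big_const_seq count_predT iter_addr_0 mulr_natl.
  rewrite mulr_sumr -sumrMnl -big_split; apply: ler_sum => j _ /=.
  by rewrite -subr_ge0 addrAC -sqrrB sqr_ge0.
by rewrite /= -natr1; nra.
Qed.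

Section NormC.
Variable R : realType.
Implicit Types z : R[i].

Lemma sqr_normcE z : Normc.normc z ^+ 2 = complex.Re z ^+ 2 + complex.Im z ^+ 2.
Proof. by case: z => a b /=; rewrite sqr_sqrtr // addr_ge0 ?sqr_ge0. Qed.

Lemma normc_ge0 z : 0 <= Normc.normc z.
Proof. by case: z => a b; exact: sqrtr_ge0. Qed.

Lemma trig_expD a b x : trig_exp (a + b) x = trig_exp a x * trig_exp b x :> R[i].
Proof.
have E : 2 * pi * (a + b)%:R * x = 2 * pi * a%:R * x + 2 * pi * b%:R * x :> R.
  by rewrite natrD; ring.
rewrite /trig_exp E cosD sinD; apply/eqP; rewrite eq_complex /= eqxx /=.
by rewrite addrC.
Qed.

End NormC.

(** * Means over the unit interval and Parseval's identity *)

Section Mean.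
Variable R : realType.
Implicit Types f g : R -> R.

(* [v] is the integral of [f] over [0, 1], witnessed by a primitive so that
   linearity needs no integrability side conditions. *)
Definition has_mean f (v : R) : Prop :=
  continuous f /\
  exists2 G : R -> R, forall x : R, is_derive x (1 : R) G (f x) & G 1 - G 0 = v.

Lemma has_mean_cst (a : R) : has_mean (fun=> a) a.
Proof.
split; first by move=> x; exact: cvg_cst.
exists (a *: (@id R)) => [x|]; last by rewrite !fctE /GRing.scale /=; ring.
by apply: is_derive_eq; rewrite /GRing.scale /= mulr1.
Qed.

Lemma has_meanD f g v w :
  has_mean f v -> has_mean g w -> has_mean (fun x => f x + g x) (v + w).
Proof.
move=> [cf [F dF <-]] [cg [G dG <-]]; split.
  by move=> x; apply: cvgD; [exact: cf|exact: cg].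
by exists (F + G) => [x|]; [exact: is_deriveD|rewrite !fctE; ring].
Qed.

Lemma has_meanZ (a : R) f v : has_mean f v -> has_mean (fun x => a * f x) (a * v).
Proof.
move=> [cf [F dF <-]]; split.
  by move=> x; apply: cvgM; [exact: cvg_cst|exact: cf].
by exists (a *: F) => [x|]; [exact: is_deriveZ|rewrite !fctE /GRing.scale /=; ring].
Qed.

Lemma has_mean_sum (I : Type) (s : seq I) (f : I -> R -> R) (v : I -> R) :
  (forall i, has_mean (f i) (v i)) ->
  has_mean (fun x => \sum_(i <- s) f i x) (\sum_(i <- s) v i).
Proof.
move=> H; elim: s => [|i s IH].
  rewrite big_nil (_ : (fun x => _) = fun=> 0); first exact: has_mean_cst.
  by apply/funext => x; rewrite big_nil.
rewrite big_cons (_ : (fun x => _) = fun x => f i x + \sum_(j <- s) f j x).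
  exact: has_meanD.
by apply/funext => x; rewrite big_cons.
Qed.

(** The hypotheses say that [w] is a multiple of the period. For [w != 0] the primitives
    [sin (w x) / w] and [- cos (w x) / w] therefore agree at 0 and 1; for [w = 0] the integrands are
    constant. *)
Lemma has_mean_trig (w : R) : sin w = 0 -> cos w = 1 ->
  has_mean (fun x => cos (w * x)) (w == 0)%:R /\
  has_mean (fun x => sin (w * x)) 0.
Proof.
move=> sw cw; have [->|w0] := eqVneq w 0.
  rewrite (_ : (fun x => cos _) = fun=> 1); last first.
    by apply/funext => x; rewrite mul0r cos0.
  rewrite (_ : (fun x => sin _) = fun=> 0); last first.
    by apply/funext => x; rewrite mul0r sin0.
  by split; exact: has_mean_cst.
have dw (x : R) : is_derive x (1 : R) (w *: (@id R)) w.
  by apply: is_derive_eq; rewrite /GRing.scale /= mulr1.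
have cont : continuous (fun x : R => w * x).
  by move=> x; apply: cvgM; [exact: cvg_cst|exact: cvg_id].
split; split.
- by move=> x; apply: continuous_comp; [exact: cont|exact: continuous_cos].
- exists (w^-1 *: (@sin R \o (w *: (@id R)))) => [x|].
    have dc := is_derive1_comp (is_derive_sin ((w *: (@id R)) x)) (dw x).
    apply: (is_derive_eq (is_deriveZ w^-1 dc)).
    by rewrite /GRing.scale /= mulrC mulfK.
  by rewrite !fctE /GRing.scale /= mulr0 mulr1 sin0 sw; ring.
- by move=> x; apply: continuous_comp; [exact: cont|exact: continuous_sin].
- exists ((- w^-1) *: (@cos R \o (w *: (@id R)))) => [x|].
    have dc := is_derive1_comp (is_derive_cos ((w *: (@id R)) x)) (dw x).
    apply: (is_derive_eq (is_deriveZ (- w^-1) dc)).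
    by rewrite /GRing.scale /= mulrC mulNr mulrNN mulfK.
  by rewrite !fctE /GRing.scale /= mulr0 mulr1 cos0 cw; ring.
Qed.

Definition trig_poly (F : seq nat) (p : nat -> R[i]) (x : R) : R[i] :=
  \sum_(m <- F) p m * trig_exp m x.

(** Each summand is the real part of $p_a\overline{p_b}e^{2\pi i(a-b)x}$; the real form lets the
    means be taken term by term. *)
Lemma sqr_normc_trig_polyE F p x : Normc.normc (trig_poly F p x) ^+ 2 =
  \sum_(a <- F) \sum_(b <- F)
   ((complex.Re (p a) * complex.Re (p b) + complex.Im (p a) * complex.Im (p b)) *
      cos ((2 * pi * a%:R - 2 * pi * b%:R) * x) +
    (complex.Re (p a) * complex.Im (p b) - complex.Im (p a) * complex.Re (p b)) *
      sin ((2 * pi * a%:R - 2 * pi * b%:R) * x)).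
Proof.
rewrite sqr_normcE /trig_poly.
have -> (z : nat -> R[i]) : complex.Re (\sum_(a <- F) z a) =
  \sum_(a <- F) complex.Re (z a) by rewrite raddf_sum.
have -> (z : nat -> R[i]) : complex.Im (\sum_(a <- F) z a) =
  \sum_(a <- F) complex.Im (z a) by rewrite raddf_sum.
rewrite !expr2 !mulr_suml -big_split; apply: eq_bigr => a _ /=.
rewrite !mulr_sumr -big_split; apply: eq_bigr => b _ /=.
rewrite !mulrBl cosB sinB.
by case: (p a) => a1 a2; case: (p b) => b1 b2; rewrite /trig_exp /=; ring.
Qed.

Lemma parseval F p : uniq F ->
  has_mean (fun x => Normc.normc (trig_poly F p x) ^+ 2)
           (\sum_(m <- F) Normc.normc (p m) ^+ 2).
Proof.
move=> uF; under eq_fun do rewrite sqr_normc_trig_polyE.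
have pi2 : 2 * pi != 0 :> R by rewrite mulf_neq0 ?pnatr_eq0 // gt_eqF // pi_gt0.
have E a : 2 * pi * a%:R = 0 + pi *+ 2 *+ a :> R.
  by rewrite -mulr_natr -[pi *+ 2]mulr_natr; ring.
have sn a : sin (2 * pi * a%:R) = 0 :> R.
  by rewrite E (periodicn (@sinD2pi R)) sin0.
have cn a : cos (2 * pi * a%:R) = 1 :> R.
  by rewrite E (periodicn (@cosD2pi R)) cos0.
have -> : \sum_(m <- F) Normc.normc (p m) ^+ 2 = \sum_(a <- F) \sum_(b <- F)
   ((complex.Re (p a) * complex.Re (p b) + complex.Im (p a) * complex.Im (p b)) *
      (2 * pi * a%:R - 2 * pi * b%:R == 0 :> R)%:R +
    (complex.Re (p a) * complex.Im (p b) - complex.Im (p a) * complex.Re (p b)) *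
      0).
  rewrite big_seq [RHS]big_seq; apply: eq_bigr => a aF.
  rewrite (bigD1_seq a) //= subrr eqxx big1 => [|b ba].
    by rewrite sqr_normcE mulr1 mulr0 !addr0 !expr2.
  rewrite subr_eq0 (inj_eq (mulfI pi2)).
  by rewrite eqr_nat eq_sym (negbTE ba) !mulr0 addr0.
apply: has_mean_sum => a; apply: has_mean_sum => b.
have [||hc hs] := @has_mean_trig (2 * pi * a%:R - 2 * pi * b%:R).
- by rewrite sinB !sn !cn; ring.
- by rewrite cosB !sn !cn; ring.
by apply: has_meanD; apply: has_meanZ.
Qed.

End Mean.

(** * The fourth moment of a trigonometric polynomial *)

Section FourthMoment.

(** Pairs are grouped by [m = a + b]. The bound [M] precedes [V] and [g], so one [M] serves both the
    complex coefficients of the squared polynomial and the real sum that bounds them. *)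
Lemma sum_conv (F : seq nat) : uniq F ->
  exists M : nat, forall (V : nmodType) (g : nat -> nat -> V),
  \sum_(a <- F) \sum_(b <- F) g a b =
  \sum_(m <- iota 0 M) \sum_(a <- F | (a <= m)%N && ((m - a)%N \in F)) g a (m - a)%N.
Proof.
move=> uF; exists (\max_(a <- F) a).*2.+1 => V g.
rewrite [RHS](exchange_big_dep predT) //= big_seq [RHS]big_seq.
apply: eq_bigr => a aF.
have le b : b \in F -> (b <= \max_(a <- F) a)%N by move=> bF; exact: leq_bigmax_seq.
(* For fixed [a] the admissible [m] are the translates [a + b] with [b] in [F], all at most twice
   the maximum of [F]. *)
have P : perm_eq [seq m <- iota 0 (\max_(a <- F) a).*2.+1 |
    (a <= m)%N && ((m - a)%N \in F)] [seq (a + b)%N | b <- F].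
  apply: uniq_perm; first exact/filter_uniq/iota_uniq.
    by rewrite map_inj_uniq // => x y /addnI.
  move=> m; rewrite mem_filter mem_iota /= add0n ltnS.
  apply/idP/mapP => [/andP[/andP[am mF] _]|[b bF ->]].
    by exists (m - a)%N => //; rewrite subnKC.
  by rewrite leq_addr addKn bF -addnn leq_add ?le.
rewrite -[RHS]big_filter (perm_big _ P) big_map.
by apply: eq_bigr => b _; rewrite addKn.
Qed.

Variable R : realType.

(** The square of the polynomial has coefficients [q m], so Parseval gives the fourth moment as the
    sum of their squared moduli. Each [q m] has at most [C] terms, and Cauchy-Schwarz bounds it. *)
Lemma fourth_moment (F : seq nat) (p : nat -> R[i]) (C : nat) : uniq F ->
  (forall m, count (fun a => (a <= m) && (m - a \in F)) F <= C)%N ->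
  exists2 W : R, W <= C%:R * (\sum_(m <- F) Normc.normc (p m) ^+ 2) ^+ 2 &
  has_mean (fun x => (Normc.normc (trig_poly F p x) ^+ 2) ^+ 2) W.
Proof.
move=> uF HC; have [M HM] := sum_conv uF.
pose q m := \sum_(a <- F | (a <= m)%N && ((m - a)%N \in F)) p a * p (m - a)%N.
exists (\sum_(m <- iota 0 M) Normc.normc (q m) ^+ 2); last first.
  have -> : (fun x => (Normc.normc (trig_poly F p x) ^+ 2) ^+ 2) =
            (fun x => Normc.normc (trig_poly (iota 0 M) q x) ^+ 2).
    apply/funext => x; rewrite [X in X ^+ 2 = _]expr2 -Normc.normcM; congr (_ ^+ 2).
    congr Normc.normc.
    rewrite /trig_poly mulr_suml; under eq_bigr do rewrite mulr_sumr.
    rewrite HM; apply: eq_bigr => m _; rewrite /q mulr_suml.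
    apply: eq_bigr => a /andP[am _].
    by rewrite -[in RHS](subnKC am) trig_expD addKn; ring.
  exact/parseval/iota_uniq.
rewrite expr2 mulr_suml; under [in leRHS]eq_bigr do rewrite mulr_sumr.
rewrite HM mulr_sumr; apply: ler_sum => m _.
(* Real and imaginary parts are separated because [sqr_sum_le] concerns real sums. *)
have -> : \sum_(a <- F | (a <= m)%N && ((m - a)%N \in F))
      Normc.normc (p a) ^+ 2 * Normc.normc (p (m - a)%N) ^+ 2 =
  \sum_(a <- F | (a <= m)%N && ((m - a)%N \in F))
     complex.Re (p a * p (m - a)%N) ^+ 2 +
  \sum_(a <- F | (a <= m)%N && ((m - a)%N \in F))
     complex.Im (p a * p (m - a)%N) ^+ 2.
  by rewrite -big_split; apply: eq_bigr => a _; rewrite -exprMn -Normc.normcM sqr_normcE.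
rewrite sqr_normcE /q.
have -> (z : nat -> R[i]) (P : pred nat) : complex.Re (\sum_(a <- F | P a) z a) =
  \sum_(a <- F | P a) complex.Re (z a) by rewrite raddf_sum.
have -> (z : nat -> R[i]) (P : pred nat) : complex.Im (\sum_(a <- F | P a) z a) =
  \sum_(a <- F | P a) complex.Im (z a) by rewrite raddf_sum.
rewrite mulrDr; apply: lerD; apply: le_trans (sqr_sum_le _ _ _) _;
  by apply: ler_wpM2r; rewrite ?ler_nat ?HC // sumr_ge0 // => a _; exact: sqr_ge0.
Qed.

End FourthMoment.

(** * Coefficient bounds from boundedness on a large set *)

Section Measure.
Variable R : realType.
Notation mu := (@lebesgue_measure R).

(** On the unit interval [f] is dominated by [D] times the indicator of the complement of [B], a set
    of measure at most [1 - alpha]. The fundamental theorem of calculus turns [v] into a Lebesgue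
    integral. *)
Lemma has_mean_le (f : R -> R) (v D alpha : R) (B : set (measurableTypeR R)) :
  has_mean f v -> measurable B -> B `<=` `[0, 1] -> (alpha%:E <= mu B)%E ->
  0 <= D -> (forall x, f x <= D) -> (forall x, B x -> f x <= 0) ->
  v <= D * (1 - alpha).
Proof.
move=> [cf [G dG <-]] mB B01 aB D0 fD fB.
have cG : continuous G.
  by move=> x; apply/differentiable_continuous/derivable1_diffP; apply: ex_derive.
have mI : measurable (`[0, 1]%classic : set (measurableTypeR R)) by exact: measurable_itv.
have intf : mu.-integrable `[0, 1] (EFin \o f).
  apply: continuous_compact_integrable; first exact: segment_compact.
  exact: continuous_subspaceT.
have FTC : (\int[mu]_(x in `[0%R, 1%R]) (f x)%:E = (G 1 - G 0)%:E)%E.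
  rewrite (@continuous_FTC2 _ f G) //.
  - exact: continuous_subspaceT.
  - split; first by move=> x _; apply: ex_derive.
    + exact/cvg_at_right_filter/cG.
    + exact/cvg_at_left_filter/cG.
  - by move=> x _; rewrite derive1E; apply: derive_val.
pose A : set (measurableTypeR R) := `[0, 1] `\` B.
have mA : measurable A by exact: measurableD.
have muI : mu `[0, 1] = 1%:E by rewrite lebesgue_measure_itv /= lte01 sube0.
have AI : `[0, 1] `&` A = A by rewrite /A setIDA setIid.
have muA : mu A = (1 - mu B)%E.
  rewrite /A measureD //; first by rewrite setIidr // -muI.
  by rewrite -[X in (X < _)%E]/(mu `[0, 1]) muI ltry.
have intc : mu.-integrable `[0, 1] (EFin \o cst D).
  apply: continuous_compact_integrable; first exact: segment_compact.
  by apply: continuous_subspaceT => x; exact: cvg_cst.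
have intD : mu.-integrable `[0, 1] ((cst D%:E) \_ A).
  apply/(integrable_restrict mu mA mI).
  by apply: integrableS intc => //; exact: measurableI.
rewrite -lee_fin.
have fg : forall x, x \in (`[0, 1]%classic : set (measurableTypeR R)) ->
    ((EFin \o f) x <= ((cst D%:E) \_ A) x)%E.
  move=> x /set_mem x01.
  rewrite patchE; case: ifPn => [_|]; rewrite lee_fin //=.
  by move=> /negP nx; apply: fB; apply: contrapT => nB; apply/nx/mem_set.
have := le_integral mI intf intD fg; rewrite [leLHS]FTC => /le_trans; apply.
rewrite -integral_mkcondr AI integral_cst // [X in (_ * X)%E]muA EFinM EFinB.
by apply: lee_wpmul2l; rewrite ?lee_fin //; apply: leeB.
Qed.

(* [u <= u^2 / (4 a) + a] with [u = |P|^2] and [a = C S], where [S] is the sum to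
   be bounded, lets the fourth moment absorb the integral of [|P|^2] off [B]. *)
Lemma coef_sqr_sum_le (F : seq nat) (p : nat -> R[i]) (C : nat) (K alpha : R)
    (B : set (measurableTypeR R)) :
  uniq F -> (forall m, count (fun a => (a <= m) && (m - a \in F))%N F <= C)%N ->
  (0 < C)%N -> measurable B -> B `<=` `[0, 1] -> (alpha%:E <= mu B)%E ->
  1 - alpha <= (4 * C%:R)^-1 ->
  (forall x, B x -> Normc.normc (trig_poly F p x) ^+ 2 <= K) ->
  \sum_(m <- F) Normc.normc (p m) ^+ 2 <= 2 * K.
Proof.
move=> uF HC C0 mB B01 aB ha HK.
(* [B] cannot be empty: that would force [alpha <= 0], against [1 - alpha <= 1 / (4 C) < 1]. *)
have K0 : 0 <= K.
  have [[x Bx]|nB] := pselect (exists x, B x).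
    by apply: le_trans (HK x Bx); exact: sqr_ge0.
  have B0 : B = set0 by apply/seteqP; split=> // x Bx; case: nB; exists x.
  move: aB; rewrite B0 measure0 lee_fin => a0.
  have : (4 * C%:R : R)^-1 < 1.
    rewrite invf_lt1 ?mulr_gt0 ?ltr0n //.
    by have C1 : 1 <= C%:R :> R; [rewrite ler1n|lra].
  by lra.
set S := \sum_(m <- F) _.
have : 0 <= S by apply: sumr_ge0 => m _; exact: sqr_ge0.
rewrite le_eqVlt => /orP[/eqP <-|S0]; first by rewrite mulr_ge0.
have [W HW mW] := fourth_moment p uF HC.
pose a := C%:R * S.
have C0R : 0 < C%:R :> R by rewrite ltr0n.
have a0 : 0 < a by rewrite mulr_gt0.
(* The test function [u - u^2 / (4 a) - K] is at most [a] everywhere, by completing the square, and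
   at most 0 on [B], where [u <= K]. *)
have mg : has_mean (fun x => Normc.normc (trig_poly F p x) ^+ 2 +
    (- (4 * a)^-1 * (Normc.normc (trig_poly F p x) ^+ 2) ^+ 2 + - K))
    (S + (- (4 * a)^-1 * W + - K)).
  apply: has_meanD; first exact: parseval.
  by apply: has_meanD; [exact: has_meanZ|exact: has_mean_cst].
have inv0 : 0 <= (4 * a)^-1 by rewrite invr_ge0 mulr_ge0 // ltW.
have ga x : Normc.normc (trig_poly F p x) ^+ 2 +
    (- (4 * a)^-1 * (Normc.normc (trig_poly F p x) ^+ 2) ^+ 2 + - K) <= a.
  set u := _ ^+ 2.
  have -> : u + (- (4 * a)^-1 * u ^+ 2 + - K) =
     a - K - (4 * a)^-1 * (u - 2 * a) ^+ 2 by field; rewrite gt_eqF.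
  by have := mulr_ge0 inv0 (sqr_ge0 (u - 2 * a)); lra.
have gB x : B x -> Normc.normc (trig_poly F p x) ^+ 2 +
    (- (4 * a)^-1 * (Normc.normc (trig_poly F p x) ^+ 2) ^+ 2 + - K) <= 0.
  move=> Bx; have := HK x Bx.
  by have := mulr_ge0 inv0 (sqr_ge0 (Normc.normc (trig_poly F p x) ^+ 2)); lra.
(* This gives [S - W / (4 a) - K <= a (1 - alpha)]. Both [W / (4 a)] and [a (1 - alpha)] are at most
   [S / 4], hence [S / 2 <= K]. *)
have := has_mean_le mg mB B01 aB (ltW a0) ga gB.
have : (4 * a)^-1 * W <= S / 4.
  rewrite mulrC ler_pdivrMr ?mulr_gt0 //; apply: le_trans HW _.
  by rewrite le_eqVlt; apply/orP; left; apply/eqP; rewrite /a -/S; field.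
have : a * (1 - alpha) <= S / 4.
  apply: le_trans (ler_wpM2l (ltW a0) ha) _.
  by rewrite le_eqVlt; apply/orP; left; apply/eqP; rewrite /a; field; rewrite gt_eqF.
by lra.
Qed.

End Measure.

(** * Summation matrices and uniform boundedness on a Borel set *)

Section Summation.
Variable R : realType.
Implicit Types (A : set nat) (t : nat -> int -> R[i]) (c : nat -> R[i]).

(** The spectrum [F] is cut out by [t n m != 0] alone, whatever [c m] is. It is thus finite and
    contains every index of [A] at which the row does not vanish. *)
Lemma summation_mean_trig_poly A t c n : finite_set [set m : int | t n m != 0] ->
  exists F : seq nat, [/\ uniq F, forall m, m \in F -> A m,
    forall m, A m -> t n m%:Z != 0 -> m \in F &
    forall x, summation_mean A t c n x = trig_poly F (fun m => t n m%:Z * c m) x].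
Proof.
move=> fin.
have finA : finite_set (A `&` (Posz @^-1` [set m : int | t n m != 0])).
  by apply: finite_setIr; apply: finite_preimage fin => // ? ? _ _ [].
pose X := A `&` (Posz @^-1` [set m : int | t n m != 0]).
have memX m : (m \in finmap.enum_fset (fset_set X)) = (m \in X).
  exact: in_fset_set.
exists (finmap.enum_fset (fset_set X)); split.
- exact: finmap.fset_uniq.
- by move=> m; rewrite memX => /set_mem[].
- by move=> m Am tm; rewrite memX; apply/mem_set.
move=> x; rewrite /summation_mean /trig_poly -fsbig_finite //.
apply/esym/fsbig_widen; first exact: subIsetl.
move=> m [Am nX]; have [t0|tm] := eqVneq (t n m%:Z) 0.
  by rewrite /= t0 !mul0r.
by case: nX.
Qed.

(** Convergence is only pointwise in [m], so a common row is sought for finitely many indices;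
    [|1 - t| < 1/2] forces [|t| > 1/2]. *)
Lemma summation_matrix_near t (X : seq nat) : summation_matrix t ->
  (forall m, m \in X -> (0 < m)%N) ->
  exists n, forall m, m \in X -> 1 / 2 <= Normc.normc (t n m%:Z).
Proof.
move=> [_ _ tcvg] X0.
suff [n _ Hn] : \forall n \near \oo, forall m, m \in X ->
    1 / 2 <= Normc.normc (t n m%:Z).
  by exists n; apply: Hn => /=.
elim: X X0 => [|m X IH] X0; first by near=> n.
have m0 : (0 < m)%N by apply: X0; rewrite mem_head.
have {}IH := IH (fun k kX => X0 k (mem_behead (s := m :: X) kX)).
have half0 : (0 : R[i]) < ((1 / 2 : R)%:C)%C by rewrite ltcR divr_gt0.
have /cvgr_dist_lt/(_ _ half0) near_m := tcvg m m0.
near=> n => k; rewrite inE => /orP[/eqP ->|kX].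
  have : `|(1 : R[i]^o) - t n m%:Z| < ((1 / 2 : R)%:C)%C by near: n.
  rewrite normc_def -sqr_normcE sqrtr_sqr ltcR ger0_norm ?normc_ge0 //.
  have := le_normcD (1 - t n m%:Z) (t n m%:Z).
  by rewrite subrK Normc.normc1; lra.
by have : forall k, k \in X -> 1 / 2 <= Normc.normc (t n k%:Z); [near: n|apply].
Unshelve. all: by end_near. Qed.

Lemma sum_subseq_le (X F : seq nat) (g : nat -> R) : uniq X -> uniq F ->
  {subset X <= F} -> (forall m, 0 <= g m) ->
  \sum_(m <- X) g m <= \sum_(m <- F) g m.
Proof.
move=> uX uF XF g0.
have P : perm_eq X [seq m <- F | m \in X].
  apply: uniq_perm => //; first exact: filter_uniq.
  by move=> m; rewrite mem_filter; case: (boolP (m \in X)) => // /XF ->.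
rewrite (perm_big _ P) big_filter big_mkcond; apply: ler_sum => m _.
by case: ifP.
Qed.

(** The sets [B k] where all [P n] are at most [k] are Borel by continuity, increase with [k] and
    cover [E]. Continuity of the measure from below then finds one of measure above [alpha]. *)
Lemma bounded_trig_polys_measure (P : nat -> R -> R) (E : set R) (alpha : R) :
  (forall n, continuous (P n)) -> E `<=` [set x | 0 < x < 1] ->
  (alpha%:E < completed_lebesgue_measure E)%E ->
  (forall x, E x -> exists K : R, forall n, P n x <= K) ->
  exists K : R, exists B : set (measurableTypeR R),
    [/\ measurable B, B `<=` `[0, 1], (alpha%:E <= lebesgue_measure B)%E &
        forall n x, B x -> P n x <= K].
Proof.
move=> cP E01 aE EK.
pose B (k : nat) : set (measurableTypeR R) :=
  `[0, 1]%classic `&` \bigcap_n (P n @^-1` [set y | y <= k%:R]).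
have mB k : measurable (B k).
  apply: measurableI; first exact: measurable_itv.
  apply: bigcapT_measurable => n.
  apply: measurable_realfun.closed_measurable.
  by apply: preimage_closed; [move=> x _; exact: cP|exact: closed_le].
have mU : measurable (\bigcup_k B k) by exact: bigcupT_measurable.
have EB : E `<=` \bigcup_k B k.
  move=> x Ex; have [K HK] := EK x Ex.
  exists (Num.bound `|K|) => //; split.
    by have := E01 x Ex; rewrite /= in_itv /= => /andP[/ltW -> /ltW ->].
  move=> n _ /=; apply: le_trans (HK n) _; apply: le_trans (ler_norm _) _.
  exact/ltW/archi_boundP/normr_ge0.
(* Both measures are values of the same outer measure, which is monotone. *)
have aU : (alpha%:E < lebesgue_measure (\bigcup_k B k))%E.
  by apply: lt_le_trans aE _; exact: le_outer_measure.
have hom : {homo B : n m / (n <= m)%N >-> (n <= m)%O}.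
  move=> n m nm; apply/subsetPset => x [x01 Hx]; split=> // i _ /=.
  by apply: le_trans (Hx i I) _; rewrite ler_nat.
have cvgB := nondecreasing_cvg_mu mB mU hom (mu := lebesgue_measure).
have [k /ltW ak] : exists k, (alpha%:E < lebesgue_measure (B k))%E.
  apply: contrapT => no.
  have : (lebesgue_measure (\bigcup_k B k) <= alpha%:E)%E.
    apply: (cvge_le _ cvgB).
    by apply: nearW => k /=; rewrite leNgt; apply/negP => h; apply: no; exists k.
  by rewrite leNgt aU.
exists k%:R, (B k); split=> // [x []//|n x [_ Hx]].
exact: Hx.
Qed.

End Summation.

Unset Implicit Arguments.

(** * From bounded means to square-summable coefficients *)

Theorem theorem1p3 (R : realType) (l : nat) (lambda : R) :
  (2 <= l)%N -> lambda_succ R l < lambda ->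
  exists alpha : R, 0 < alpha < 1 /\
    forall (N : nat -> nat) (t : nat -> int -> R[i]) (c : nat -> R[i])
           (E : set R),
      lacunary lambda N ->
      summation_matrix t ->
      lebesgue_measurable E ->
      E `<=` [set x | 0 < x < 1] ->
      (alpha%:E < completed_lebesgue_measure E)%E ->
      (forall x, E x ->
        (ereal_sup (range (fun n : nat =>
           (Normc.normc (summation_mean (plus_sums_upto N l) t c n x))%:E))
         < +oo)%E) ->
      (\esum_(m in plus_sums_upto N l) ((Normc.normc (c m)) ^+ 2)%:E < +oo)%E.
Proof.
move=> l2 hl.
have l1 : 1 < lambda by apply: lt_trans hl; have [] := @lambda_succP R l l2.
have [C HC] := plus_sums_reps l l1.
have C1 : 1 <= C.+1%:R :> R by rewrite ler1n.
have C4 : 0 < 4 * C.+1%:R :> R by rewrite mulr_gt0.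
(* [C] was obtained from [l] and [lambda] before any sequence. Its successor keeps the denominator
   positive even when [C] is 0. *)
exists (1 - (4 * C.+1%:R)^-1); split.
  by rewrite subr_gt0 invf_lt1 // gtrBl invr_gt0 C4 andbT; lra.
move=> N t c E Nl Ht _ E01 aE Ebd.
set A := plus_sums_upto N l in Ebd *.
have [tfin _ _] := Ht.
have [F HF] : exists F : nat -> seq nat, forall n,
    [/\ uniq (F n), forall m, m \in F n -> A m,
    forall m, A m -> t n m%:Z != 0 -> m \in F n &
    forall x, summation_mean A t c n x =
      trig_poly (F n) (fun m => t n m%:Z * c m) x].
  have H n := cid (summation_mean_trig_poly A c (tfin n)).
  by exists (fun n => sval (H n)) => n; case: (H n).
pose P n x := Normc.normc (trig_poly (F n) (fun m => t n m%:Z * c m) x) ^+ 2.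
have [|x Ex|K [B [mB B01 aB HK]]] := @bounded_trig_polys_measure R P E _ _ E01 aE.
- by move=> n; have [uF _ _ _] := HF n; have [] := parseval (fun m => t n m%:Z * c m) uF.
- have sup_fin := Ebd x Ex.
  set s := ereal_sup _ in sup_fin.
  have sP n : ((Normc.normc (summation_mean A t c n x))%:E <= s)%E.
    by apply: ereal_sup_ubound; exists n.
  (* The supremum is below [+oo] by hypothesis and dominates a real value, so it is real. *)
  have [M sM] : exists M, s = M%:E.
    move: sup_fin (sP 0%N); case: s {sP} => [M| |] //=; first by exists M.
  exists (M ^+ 2) => n; have := sP n; rewrite sM lee_fin /P; have [_ _ _ ->] := HF n.
  by move=> h; rewrite ler_sqr ?nnegrE ?normc_ge0 // (le_trans (normc_ge0 _) h).
have bound n : \sum_(m <- F n) Normc.normc (t n m%:Z * c m) ^+ 2 <= 2 * K.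
  have [uF FA _ _] := HF n.
  apply: (@coef_sqr_sum_le R (F n) (fun m => t n m%:Z * c m) C.+1 K _ B uF _ _ mB B01 aB _ _) => //.
  - move=> m; apply: leq_trans (leqnSn C); apply: (HC N Nl) => // a aF.
    by apply/asboolP; exact: (FA a aF).
  - by rewrite subKr.
  - by move=> x Bx; exact: HK.
(* The sum is a supremum over finite [X]. A row with [|t| >= 1/2] on [X] gives [|c|^2 <= 4 |t c|^2]
   there, and [8 K] is 4 times the bound [2 * K]. *)
apply: le_lt_trans (ltry (8 * K)); apply: ge_ereal_sup => _ [X [finX XA] <-].
rewrite fsumEFin // lee_fin fsbig_finite //=.
set Xs := finmap.enum_fset _.
have XsA m : m \in Xs -> A m.
  by move=> mX; apply: XA; apply: set_mem; rewrite -(in_fset_set finX).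
have Xs0 m : m \in Xs -> (0 < m)%N.
  move=> /XsA [s /= /andP[s0 _] [k [ks _ ->]]].
  case: k ks s0 => [<- //|i k _ _]; rewrite big_cons ltn_addr //.
  by case: Nl.
have [n Hn] := summation_matrix_near Ht Xs0.
have [uF _ FX _] := HF n.
(* On [Xs] the entries of row [n] are nonzero, so these indices belong to its spectrum. *)
have XF : {subset Xs <= F n}.
  move=> m mX; apply: FX; first exact: XsA.
  apply/negP => /eqP t0; have := Hn m mX; rewrite t0 Normc.normc0; lra.
have uX : uniq Xs by exact: finmap.fset_uniq.
have := sum_subseq_le uX uF XF (fun m => sqr_ge0 (Normc.normc (t n m%:Z * c m))).
move=> /le_trans/(_ (bound n)) le2K.
apply: (@le_trans _ _ (4 * \sum_(m <- Xs) Normc.normc (t n m%:Z * c m) ^+ 2)); last lra.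
rewrite mulr_sumr big_seq [leRHS]big_seq; apply: ler_sum => m mX.
rewrite Normc.normcM exprMn mulrA ler_peMl ?sqr_ge0 //.
have := Hn m mX; set u := Normc.normc _ => hu; nra.
Qed.
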